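(* Let $\mathcal{P}$ be a poset on $[n]$. Then the set of normal subposets of $\mathcal{P}$ is in bijection with the set of subsets $S\subset\mathcal{P}$ which are antichains with respect to the partial ordering $\prec_\mathcal{P}$. This bijection is given explicitly by $S\mapsto\mathcal{P}_S$, where $\mathcal{P}_S$ is the poset on $[n]$ defined by $$\mathcal{P}_S=\{(i,j)\in\mathcal{P}:(i,j)\not\preceq_\mathcal{P}(k,l)\text{ for all }(k,l)\in S\}.$$
   Context: $n$ is a positive integer and $[n]=\{1,\dots,n\}$. A poset on $[n]$ means a subset $\mathcal{P}\subset\{(i,j):1\leq i<j\leq n\}$ such that $(i,j),(j,k)\in\mathcal{P}$ implies $(i,k)\in\mathcal{P}$. If $\mathcal{O}\subset\mathcal{P}$ are posets on $[n]$, then $\mathcal{O}$ is normal in $\mathcal{P}$ (a normal subposet of $\mathcal{P}$) if: (1) $(i,j)\in\mathcal{P}$ and $(j,k)\in\mathcal{O}$ imply $(i,k)\in\mathcal{O}$; and (2) $(j,k)\in\mathcal{P}$ and $(i,j)\in\mathcal{O}$ imply $(i,k)\in\mathcal{O}$. The strict partial order $\prec_\mathcal{P}$ on the set $\mathcal{P}$ is defined by setting, for $(j,k),(i,k),(j,l)\in\mathcal{P}$, $(j,k)\prec_\mathcal{P}(i,k)$ iff $(i,j)\in\mathcal{P}$, and $(j,k)\prec_\mathcal{P}(j,l)$ iff $(k,l)\in\mathcal{P}$, and extending transitively; $\preceq_\mathcal{P}$ is its reflexive closure. An antichain is a subset in which no two distinct elements are comparable. *)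

(* Defs.v *)
From mathcomp Require Import all_boot.

Set Implicit Arguments.
Unset Strict Implicit.
Unset Printing Implicit Defensive.

(* The set [n] = {1, ..., n} is represented by 'I_n = {0, ..., n - 1}; a poset
   on [n] is the set of its strictly related pairs. *)
Definition is_poset (n : nat) (P : {set 'I_n * 'I_n}) : Prop :=
  (forall i j : 'I_n, (i, j) \in P -> i < j) /\
  (forall i j k : 'I_n, (i, j) \in P -> (j, k) \in P -> (i, k) \in P).

Definition normal_subposet (n : nat) (P O : {set 'I_n * 'I_n}) : Prop :=
  [/\ is_poset O,
      O \subset P,
      forall i j k : 'I_n, (i, j) \in P -> (j, k) \in O -> (i, k) \in O
    & forall i j k : 'I_n, (j, k) \in P -> (i, j) \in O -> (i, k) \in O].

(* Generating relation of the strict order on P: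
   (j, k) is below (i, k) when (i, j) is in P, and
   (j, k) is below (j, l) when (k, l) is in P. *)
Definition prec_step (n : nat) (P : {set 'I_n * 'I_n}) : rel ('I_n * 'I_n) :=
  fun x y => [&& x \in P, y \in P &
    (x.2 == y.2) && ((y.1, x.1) \in P) || (x.1 == y.1) && ((x.2, y.2) \in P)].

(* [connect] is the reflexive transitive closure, so a first step is split off
   to obtain the transitive closure. *)
Definition prec (n : nat) (P : {set 'I_n * 'I_n}) : rel ('I_n * 'I_n) :=
  fun x y => [exists z, prec_step P x z && connect (prec_step P) z y].

Definition preceq (n : nat) (P : {set 'I_n * 'I_n}) : rel ('I_n * 'I_n) :=
  fun x y => (x == y) || prec P x y.

Definition is_antichain (n : nat) (P S : {set 'I_n * 'I_n}) : Prop :=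
  S \subset P /\
  (forall x y, x \in S -> y \in S -> x != y ->
     ~~ preceq P x y /\ ~~ preceq P y x).

Definition poset_of_antichain (n : nat) (P S : {set 'I_n * 'I_n}) :
    {set 'I_n * 'I_n} :=
  [set x in P | [forall y in S, ~~ preceq P x y]].

(* Main.v *)
Require Import Defs.
From mathcomp Require Import all_boot.
From mathcomp Require Import classical_sets functions.

(** Both closure conditions defining a normal subposet say that it is stable
    under the steps generating the order on [P], one condition for each kind of
    step. So the normal subposets of [P] are exactly the up-sets of [P]
    ([normal_up_closed], [poset_of_antichain_normal]); transitivity comes for
    free, being a special case of normality. On the other side,
    [poset_of_antichain P S] is the complement of the down-set generated
    by [S].

    The statement is thus the classical correspondence between the antichains
    and the down-sets of a finite poset, the inverse map sending a down-set to
    its maximal elements. It relies on every element of a down-set lying below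
    a maximal one ([below_maxima]), and on antisymmetry. Both follow from the
    fact that a step enlarges the interval [i, j] attached to a pair (i, j), so
    that [width], which is j - i, strictly increases along the order
    ([width_prec]). The two composites are computed in [maximaK] and
    [poset_of_antichainK]. *)

Section NormalSubposets.

Variables (n : nat) (P : {set 'I_n * 'I_n}).
Hypothesis posetP : is_poset P.

Implicit Types (S O : {set 'I_n * 'I_n}) (x y : 'I_n * 'I_n).

Lemma preceqE x y : preceq P x y = connect (prec_step P) x y.
Proof.
apply/idP/idP => [/predU1P[->|/existsP[z /andP[xz zy]]]|].
- exact: connect0.
- exact: connect_trans (connect1 xz) zy.
case/connectP=> [[|z p] /= xp ->]; first by rewrite /preceq eqxx.
case/andP: xp => xz zp; apply/orP; right; apply/existsP; exists z.
by rewrite xz; apply/connectP; exists p.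
Qed.

Lemma preceq_refl x : preceq P x x.
Proof. by rewrite preceqE connect0. Qed.

Lemma preceq_trans x y z : preceq P x y -> preceq P y z -> preceq P x z.
Proof. by rewrite !preceqE; apply: connect_trans. Qed.

Lemma step_preceq x y : prec_step P x y -> preceq P x y.
Proof. by move=> xy; rewrite preceqE connect1. Qed.

Definition width x : nat := x.2 - x.1.

Lemma width_step x y : prec_step P x y -> width x < width y.
Proof.
case: posetP => ltP _; case: x y => [j k] [i l] /and3P[Pjk Pil] /=.
have [ltjk ltil] := (ltP _ _ Pjk, ltP _ _ Pil).
case/orP=> /andP[/eqP /= eq_end /ltP lt_end]; rewrite /width /=.
  by subst l; apply: ltn_sub2l.
by subst i; apply: ltn_sub2r.
Qed.

Lemma width_preceq x y : preceq P x y -> width x <= width y.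
Proof.
rewrite preceqE => /connectP[p].
elim: p x => [|z p IHp] x /= => [_ -> //|/andP[xz zp] y_last].
exact: leq_trans (ltnW (width_step _ _ xz)) (IHp z zp y_last).
Qed.

Lemma width_prec x y : preceq P x y -> x != y -> width x < width y.
Proof.
move=> /predU1P[->|]; first by rewrite eqxx.
case/existsP=> z /andP[xz zy] _.
by apply: leq_trans (width_step _ _ xz) (width_preceq _ _ _); rewrite preceqE.
Qed.

Lemma preceq_anti x y : preceq P x y -> preceq P y x -> x = y.
Proof.
move=> xy yx; apply/eqP/negP => /negP /(width_prec _ _ xy).
by rewrite ltnNge width_preceq.
Qed.

Lemma normal_up_closed O x y :
  normal_subposet P O -> x \in O -> preceq P x y -> y \in O.
Proof.
case=> _ _ normL normR Ox; rewrite preceqE => /connectP[p].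
elim: p x Ox => [|z p IHp] x Ox /= => [_ -> //|/andP[xz zp] y_last].
apply: IHp zp y_last; case: x z Ox xz => [j k] [i l] Ojk /and3P[_ _] /=.
by case/orP=> /andP[/eqP <-] Pij; [apply: normL Ojk | apply: normR Ojk].
Qed.

Lemma poset_of_antichainP S x :
  reflect (x \in P /\ forall y, y \in S -> ~~ preceq P x y)
          (x \in poset_of_antichain P S).
Proof. by rewrite inE; apply: (iffP andP) => -[-> /forall_inP]. Qed.

Lemma poset_of_antichain_step S x y :
  x \in poset_of_antichain P S -> prec_step P x y ->
  y \in poset_of_antichain P S.
Proof.
case/poset_of_antichainP=> _ xS xy; apply/poset_of_antichainP.
split=> [|s /xS]; first by case/and3P: xy.
by apply: contra; apply: preceq_trans (step_preceq _ _ xy).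
Qed.

(** The complement of a down-set is stable under steps. Each normality condition
    is such a step, whose target lies in [P] by transitivity of [P]. *)
Lemma poset_of_antichain_normal S : normal_subposet P (poset_of_antichain P S).
Proof.
have [ltP transP] := posetP.
have sub x : x \in poset_of_antichain P S -> x \in P.
  by case/poset_of_antichainP.
have normL i j k : (i, j) \in P -> (j, k) \in poset_of_antichain P S ->
    (i, k) \in poset_of_antichain P S.
  move=> Pij Ojk; apply: (poset_of_antichain_step _ _ _ Ojk).
  by rewrite /prec_step /= (sub _ Ojk) (transP _ _ _ Pij (sub _ Ojk)) eqxx Pij.
split=> //.
- by split=> [i j /sub/ltP //|i j k /sub]; apply: normL.
- by apply/fintype.subsetP.
move=> i j k Pjk Oij; apply: (poset_of_antichain_step _ _ _ Oij).
rewrite /prec_step /= (sub _ Oij) (transP _ _ _ (sub _ Oij) Pjk) eqxx Pjk.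
by rewrite orbT.
Qed.

(** The inverse map: maximal elements of the complement of [O] in [P]. *)
Definition maxima O : {set 'I_n * 'I_n} :=
  [set x in P :\: O | [forall y in P :\: O, preceq P x y ==> (y == x)]].

Lemma maximaP O x :
  reflect (x \in P :\: O /\
           forall y, y \in P :\: O -> preceq P x y -> y = x)
          (x \in maxima O).
Proof.
rewrite [x \in maxima O]inE; apply: (iffP andP) => -[-> maxx]; split=> //.
  by move=> y Dy xy; apply/eqP; move/forall_inP/(_ y Dy)/implyP: maxx; apply.
by apply/forall_inP=> y Dy; apply/implyP => /(maxx y Dy) ->.
Qed.

(** Among the elements of the complement above [x], one of largest width is
    maximal, since anything strictly above it would be wider. *)
Lemma below_maxima O x :
  x \in P :\: O -> exists2 y, y \in maxima O & preceq P x y.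
Proof.
move=> Dx; pose above y := (y \in P :\: O) && preceq P x y.
have above_x : above x by rewrite /above Dx preceq_refl.
case: (arg_maxnP width above_x) => y /andP[Dy xy] maxy.
exists y => //; apply/maximaP; split=> // z Dz yz.
have le_zy : width z <= width y.
  by apply: maxy; rewrite /above Dz (preceq_trans _ _ _ xy yz).
apply: contraTeq le_zy => neq_zy.
by rewrite -ltnNge width_prec // eq_sym.
Qed.

Lemma maxima_antichain O : is_antichain P (maxima O).
Proof.
split=> [|x y /maximaP[Dx maxx] /maximaP[Dy maxy] neq_xy].
  by apply/fintype.subsetP=> x /maximaP[/setDP[]].
split; apply: contra neq_xy; first by move/(maxx y Dy)->.
by move/(maxy x Dx)->.
Qed.

Lemma maximaK O :
  normal_subposet P O -> poset_of_antichain P (maxima O) = O.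
Proof.
move=> normO; have [_ /fintype.subsetP subO _ _] := normO.
apply/setP=> x; apply/poset_of_antichainP/idP => [[Px xmax]|Ox].
  apply: contraT => nOx.
  have [|y /xmax /negP nxy xy] := below_maxima O x; first by rewrite inE nOx.
  by case: nxy.
split=> [|y /maximaP[/setDP[_ nOy] _]]; first exact: subO.
by apply: contra nOy; apply: normal_up_closed.
Qed.

Lemma notin_poset_of_antichain S x :
  x \in P :\: poset_of_antichain P S -> exists2 s, s \in S & preceq P x s.
Proof.
case/setDP=> Px; rewrite inE Px /= negb_forall_in => /exists_inP[s Ss].
by rewrite negbK; exists s.
Qed.

Lemma poset_of_antichainK S :
  is_antichain P S -> maxima (poset_of_antichain P S) = S.
Proof.
case=> /fintype.subsetP subS antiS.
have DS s : s \in S -> s \in P :\: poset_of_antichain P S.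
  move=> Ss; rewrite inE subS // andbT; apply/poset_of_antichainP => -[_].
  by move/(_ s Ss); rewrite preceq_refl.
apply/setP=> x; apply/maximaP/idP => [[Dx maxx]|Sx].
  have [s Ss xs] := notin_poset_of_antichain _ _ Dx.
  by rewrite -(maxx s (DS s Ss) xs).
split=> [|y Dy xy]; first exact: DS.
have [s Ss ys] := notin_poset_of_antichain _ _ Dy.
(* x <= y <= s with x and s both in the antichain S, so y is squeezed. *)
have eq_xs : x = s.
  apply/eqP; apply: contraT => /(antiS _ _ Sx Ss)[].
  by rewrite (preceq_trans _ _ _ xy ys).
by apply: preceq_anti xy; rewrite eq_xs.
Qed.

End NormalSubposets.

Local Open Scope classical_set_scope.

Theorem proposition4p2 (n : nat) (n_gt0 : (0 < n)%N)
    (P : {set 'I_n * 'I_n}) (posetP : is_poset P) :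
  set_bij [set S | is_antichain P S] [set O | normal_subposet P O]
    (poset_of_antichain P).
Proof.
split=> [S _|S T /set_mem antiS /set_mem antiT eqST|O normO].
- exact: poset_of_antichain_normal.
- rewrite -(poset_of_antichainK _ _ posetP S antiS) eqST.
  exact: poset_of_antichainK.
- exists (maxima _ P O); first exact: maxima_antichain.
  exact: maximaK.
Qed.
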